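(* Let $l_1,l_2,l_3\geq 2$ be integers with $l_1+l_2+l_3$ odd. Then $S_{1l_1l_2,l_3}+S_{1l_1l_3,l_2}+S_{1l_2l_3,l_1}$ is expressible in terms of quadratic and linear Euler sums and zeta values; explicitly, \begin{align*} &S_{1l_1l_2,l_3}+S_{1l_1l_3,l_2}+S_{1l_2l_3,l_1}\\ &=(-1)^{l_3}\sum_{i=1}^{l_2-2}(-1)^{i-1}S_{l_3,i+1}\, S_{l_1,l_2-i}+S_{1,l_1}\big(\zeta(l_2)\zeta(l_3)+\zeta(l_2+l_3)\big)\\ &\quad+(-1)^{l_2}\sum_{i=1}^{l_1-2}(-1)^{i-1}S_{l_2,i+1}\, S_{l_3,l_1-i}+S_{1,l_2}\big(\zeta(l_1)\zeta(l_3)+\zeta(l_1+l_3)\big)\\ &\quad+(-1)^{l_1}\sum_{i=1}^{l_3-2}(-1)^{i-1}S_{l_1,i+1}\, S_{l_2,l_3-i}+S_{1,l_3}\big(\zeta(l_1)\zeta(l_2)+\zeta(l_1+l_2)\big)\\ &\quad+(-1)^{l_1-1}\sum_{j=1}^{l_1-1}(-1)^{j-1}\zeta(l_1+1-j)\big(S_{l_3j,l_2}+S_{l_2j,l_3}-S_{l_3,l_2+j}-S_{l_2,l_3+j}\big)\\ &\quad+(-1)^{l_2-1}\sum_{j=1}^{l_2-1}(-1)^{j-1}\zeta(l_2+1-j)\big(S_{l_3j,l_1}+S_{l_1j,l_3}-S_{l_3,l_1+j}-S_{l_1,l_3+j}\big)\\ &\quad+(-1)^{l_3-1}\sum_{j=1}^{l_3-1}(-1)^{j-1}\zeta(l_3+1-j)\big(S_{l_1j,l_2}+S_{l_2j,l_1}-S_{l_1,l_2+j}-S_{l_2,l_1+j}\big)\\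 &\quad+(-1)^{l_1-1}\zeta(l_1+1)\big(\zeta(l_2)\zeta(l_3)+\zeta(l_2+l_3)\big)\\ &\quad+(-1)^{l_2-1}\zeta(l_2+1)\big(\zeta(l_1)\zeta(l_3)+\zeta(l_1+l_3)\big)\\ &\quad+(-1)^{l_3-1}\zeta(l_3+1)\big(\zeta(l_1)\zeta(l_2)+\zeta(l_1+l_2)\big)\\ &\quad-S_{1(l_1+l_2),l_3}-S_{1(l_1+l_3),l_2}-S_{1(l_2+l_3),l_1}. \end{align*}
   Context: For positive integers $k$ and $n\ge 0$, $H_n^{(k)}=\sum_{j=1}^n j^{-k}$ (with $H_0^{(k)}=0$) and $H_n=H_n^{(1)}$. For positive integers $s_1,\dots,s_r$ and an integer $q\geq 2$, $S_{s_1s_2\cdots s_r,q}=\sum_{n=1}^\infty \frac{H_n^{(s_1)}\cdots H_n^{(s_r)}}{n^q}$; e.g. $S_{1l_1l_2,l_3}=\sum_{n\ge1}H_nH_n^{(l_1)}H_n^{(l_2)}/n^{l_3}$, $S_{l_3j,l_2}=\sum_{n\ge1}H_n^{(l_3)}H_n^{(j)}/n^{l_2}$, $S_{1(l_1+l_2),l_3}=\sum_{n\ge1}H_nH_n^{(l_1+l_2)}/n^{l_3}$, and $S_{p,q}=\sum_{n\ge1}H_n^{(p)}/n^q$. $\zeta$ is the Riemann zeta function. *)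

(* Defs.v *)
From Stdlib Require Import Reals List Arith.
From Coquelicot Require Import Coquelicot.
Import ListNotations.
Open Scope R_scope.

(* H_n^{(k)}; [sum_n_m f a b] is the empty sum 0 when b < a, so H_0^{(k)} = 0. *)
Definition harmonic (k n : nat) : R :=
  sum_n_m (fun j => / INR j ^ k) 1 n.

(* Riemann zeta at an integer q >= 2. [Series] sums from index 0, whence the
   shift [S m]. *)
Definition zeta (q : nat) : R :=
  Series (fun m => / INR (S m) ^ q).

(* S_{s_1 ... s_r, q} for s = [s_1; ...; s_r] and q >= 2. *)
Definition euler_sum (s : list nat) (q : nat) : R :=
  Series (fun m =>
    fold_right Rmult 1 (map (fun k => harmonic k (S m)) s) / INR (S m) ^ q).

(* Main.v *)
Require Import Defs.
From Stdlib Require Import Reals List Arith Lra Lia.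
From Coquelicot Require Import Coquelicot.
Import ListNotations.
Open Scope R_scope.

(** Let U_p(m) = sum_n H_n^(p) (1/n - 1/(n+m)).  Partial fractions and Abel
    summation give
      U_p(m) = zeta(p+1) + sum_(0<i<p) (-1)^(i-1) zeta(p+1-i) H_(m-1)^(i)
               + (-1)^(p-1) sum_(0<j<m) H_j / j^p.
    Summing H_n^(p) H_m^(q) / (n^(l-1) m (n+m)) first over m gives
    sum_n H_n^(p) U_q(n) / n^l.  Summing it first over n, after expanding in
    partial fractions down to 1 / (n m^(l-1) (n+m)), gives up to sign
    sum_m H_m^(q) U_p(m) / m^l minus an alternating sum of products of two linear
    Euler sums.  Adding the three resulting relations for l = l1, l2, l3, the odd
    weight makes all six sums sum_m H_m^(a) m^(-b) sum_(j<m) H_j / j^c appear with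
    the same sign; Abel summation over each pair {a, b} turns them into the
    cubic sums. *)

(** * Series of real numbers *)

(** This restatement and the following ones fix the carrier to [R] and the operations to those of
    the reals, so that [ring], [lra] and rewriting apply to the results directly. *)
Lemma is_series_Rext (a b : nat -> R) (l : R) :
  (forall n, a n = b n) -> is_series a l -> is_series b l.
Proof. exact (is_series_ext a b l). Qed.

Lemma is_series_value (a : nat -> R) (l l' : R) :
  l = l' -> is_series a l -> is_series a l'.
Proof. now intros ->. Qed.

Lemma is_series_Rplus (a b : nat -> R) (la lb : R) :
  is_series a la -> is_series b lb ->
  is_series (fun n => a n + b n) (la + lb).
Proof. exact (is_series_plus a b la lb). Qed.

Lemma is_series_Rminus (a b : nat -> R) (la lb : R) :
  is_series a la -> is_series b lb ->
  is_series (fun n => a n - b n) (la - lb).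
Proof. exact (is_series_minus a b la lb). Qed.

Lemma is_series_Rscal (c : R) (a : nat -> R) (l : R) :
  is_series a l -> is_series (fun n => c * a n) (c * l).
Proof. exact (is_series_scal_l c a l). Qed.

Lemma is_series_zero : is_series (fun _ : nat => 0) 0.
Proof.
  apply filterlim_ext with (fun _ : nat => 0).
  - intros n. rewrite sum_n_const. ring.
  - apply filterlim_const.
Qed.

Lemma is_series_eq (a : nat -> R) (l l' : R) :
  is_series a l -> is_series a l' -> l = l'.
Proof.
  intros H H'. rewrite <- (is_series_unique _ _ H). now apply is_series_unique.
Qed.

Lemma sum_n_m_succ (f : nat -> R) (n m : nat) :
  (n <= S m)%nat -> sum_n_m f n (S m) = sum_n_m f n m + f (S m) :> R.
Proof. intros H. now rewrite sum_n_Sm. Qed.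

Lemma sum_n_m_empty (f : nat -> R) (n m : nat) :
  (m < n)%nat -> sum_n_m f n m = 0 :> R.
Proof. exact (sum_n_m_zero f n m). Qed.

Lemma sum_n_m_Rext (f g : nat -> R) (n m : nat) :
  (forall i, (n <= i <= m)%nat -> f i = g i) -> sum_n_m f n m = sum_n_m g n m :> R.
Proof. exact (sum_n_m_ext_loc f g n m). Qed.

Lemma sum_n_m_Rscal (c : R) (f : nat -> R) (n m : nat) :
  sum_n_m (fun i => c * f i) n m = c * sum_n_m f n m :> R.
Proof. exact (sum_n_m_mult_l (K := R_Ring) c f n m). Qed.

Lemma sum_n_m_Rplus (f g : nat -> R) (n m : nat) :
  sum_n_m (fun i => f i + g i) n m = sum_n_m f n m + sum_n_m g n m :> R.
Proof. exact (sum_n_m_plus (G := R_AbelianMonoid) f g n m). Qed.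

Lemma is_series_sum_n_m (f : nat -> nat -> R) (L : nat -> R) (a b : nat) :
  (forall i, (a <= i <= b)%nat -> is_series (f i) (L i)) ->
  is_series (fun k => sum_n_m (fun i => f i k) a b) (sum_n_m L a b).
Proof.
  induction b as [|b IH]; intros H.
  - destruct a as [|a].
    + rewrite sum_n_n. apply is_series_Rext with (f 0%nat).
      * intros k. now rewrite sum_n_n.
      * apply H. lia.
    + rewrite sum_n_m_zero by lia.
      apply is_series_Rext with (fun _ : nat => 0); [|exact is_series_zero].
      intros k. now rewrite sum_n_m_zero by lia.
  - destruct (le_lt_dec a (S b)) as [Hab|Hab].
    + rewrite sum_n_m_succ by lia.
      apply is_series_Rext with (fun k => sum_n_m (fun i => f i k) a b + f (S b) k).
      * intros k. now rewrite sum_n_m_succ by lia.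
      * apply is_series_Rplus; [apply IH; intros i Hi|]; apply H; lia.
    + rewrite sum_n_m_zero by lia.
      apply is_series_Rext with (fun _ : nat => 0); [|exact is_series_zero].
      intros k. now rewrite sum_n_m_zero by lia.
Qed.

Lemma is_series_of_partial_sums (a u : nat -> R) (l : R) :
  (forall n, sum_n a n = u n :> R) -> is_lim_seq u l -> is_series a l.
Proof.
  intros H Hu. apply (is_lim_seq_ext u (sum_n a)) in Hu; [exact Hu|].
  intros n. now rewrite H.
Qed.

Lemma is_lim_seq_partial_sums (a : nat -> R) (l : R) :
  is_series a l -> is_lim_seq (sum_n a) l.
Proof. intros H; exact H. Qed.

Lemma sum_n_succ (a : nat -> R) (n : nat) :
  sum_n a (S n) = sum_n a n + a (S n) :> R.
Proof. now rewrite sum_Sn. Qed.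

Lemma sum_n_le_is_series (a : nat -> R) (l : R) (n : nat) :
  (forall k, 0 <= a k) -> is_series a l -> sum_n a n <= l.
Proof.
  intros Ha H. apply is_lim_seq_partial_sums in H.
  apply (is_lim_seq_incr_compare (sum_n a) l H).
  intros k. rewrite sum_n_succ. specialize (Ha (S k)). lra.
Qed.

Lemma ex_series_of_bounded_sums (a : nat -> R) (M : R) :
  (forall k, 0 <= a k) -> (forall n, sum_n a n <= M) ->
  exists l, is_series a l /\ l <= M.
Proof.
  intros Ha HM.
  destruct (ex_finite_lim_seq_incr (sum_n a) M) as [l Hl].
  - intros n. rewrite sum_n_succ. specialize (Ha (S n)). lra.
  - exact HM.
  - exists l. split; [exact Hl|].
    change (Rbar_le l M).
    apply (is_lim_seq_le (sum_n a) (fun _ => M)); auto using is_lim_seq_const.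
Qed.

Lemma ex_series_dominated (a b : nat -> R) :
  (forall n, 0 <= a n <= b n) -> ex_series b -> ex_series a.
Proof.
  intros H Hb. apply (@ex_series_le R_AbsRing R_CompleteNormedModule a b); [|exact Hb].
  intros n. change (Rabs (a n) <= b n).
  rewrite Rabs_pos_eq; apply H.
Qed.

(** Each column converges because its entries are bounded by the row sums. A finite sum of columns
    is a series of truncated rows, hence at most [L]. The column sums are produced rather than
    assumed, so that the lemma can be applied again to the transposed array. *)
Lemma tonelli_le (a : nat -> nat -> R) (r : nat -> R) (L : R) :
  (forall n m, 0 <= a n m) ->
  (forall n, is_series (a n) (r n)) -> is_series r L ->
  exists c L', (forall m, is_series (fun n => a n m) (c m)) /\
    is_series c L' /\ L' <= L.
Proof.
  intros Ha Hr HL.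
  assert (Hr0 : forall n, 0 <= r n).
  { intros n. apply Rle_trans with (sum_n (a n) 0).
    - rewrite sum_O. apply Ha.
    - now apply sum_n_le_is_series. }
  assert (Hcol : forall m, ex_series (fun n => a n m)).
  { intros m. apply ex_series_dominated with r; [|now exists L].
    intros n. split; [apply Ha|].
    apply Rle_trans with (sum_n (a n) m); [|now apply sum_n_le_is_series].
    destruct m as [|m]; [rewrite sum_O; lra|].
    rewrite sum_n_succ.
    enough (0 <= sum_n (a n) m) by lra.
    clear - Ha. induction m as [|m IH].
    - rewrite sum_O. apply Ha.
    - rewrite sum_n_succ. specialize (Ha n (S m)). lra. }
  set (c := fun m => Series (fun n => a n m)).
  assert (Hc : forall m, is_series (fun n => a n m) (c m)).
  { intros m. now apply Series_correct. }
  assert (Hc0 : forall m, 0 <= c m).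
  { intros m. apply Rle_trans with (sum_n (fun n => a n m) 0).
    - rewrite sum_O. apply Ha.
    - apply sum_n_le_is_series; auto. }
  destruct (ex_series_of_bounded_sums c L Hc0) as [L' [H1 H2]].
  - intros M.
    assert (HM : is_series (fun n => sum_n_m (fun m => a n m) 0 M) (sum_n c M)).
    { apply (is_series_sum_n_m (fun m n => a n m)). intros i _. apply Hc. }
    rewrite <- (is_series_unique _ _ HM), <- (is_series_unique _ _ HL).
    apply Series_le; [|now exists L].
    intros n. split.
    + rewrite <- (Rmult_0_r (INR (S M - 0))), <- (sum_n_m_const 0 M 0).
      apply sum_n_m_le. intros k. apply Ha.
    + apply (sum_n_le_is_series (a n)); auto.
  - now exists c, L'.
Qed.

(** Going from rows to columns and back by [tonelli_le] gives L'' <= L' <= L. Uniqueness of row sums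
    gives L'' = L, so equality holds throughout. *)
Lemma tonelli (a : nat -> nat -> R) (r c : nat -> R) (L : R) :
  (forall n m, 0 <= a n m) ->
  (forall n, is_series (a n) (r n)) -> is_series r L ->
  (forall m, is_series (fun n => a n m) (c m)) -> is_series c L.
Proof.
  intros Ha Hr HL Hc'.
  destruct (tonelli_le a r L Ha Hr HL) as [c0 [L' [Hc [HL' Hle]]]].
  destruct (tonelli_le (fun m n => a n m) c0 L' (fun n m => Ha m n) Hc HL')
    as [r' [L'' [Hr' [HL'' Hle']]]].
  assert (L'' = L).
  { apply (is_series_eq r); [|exact HL].
    apply is_series_Rext with r'; [|exact HL''].
    intros n. exact (is_series_eq _ _ _ (Hr' n) (Hr n)). }
  replace L with L' by lra.
  apply is_series_Rext with c0; [|exact HL'].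
  intros m. exact (is_series_eq _ _ _ (Hc m) (Hc' m)).
Qed.

(** The summand is F(k+1) G(k+1) - F(k) G(k), so the series telescopes and the initial term
    vanishes. *)
Lemma is_series_abel (F G : nat -> R) (l : R) :
  F 0%nat * G 0%nat = 0 -> is_lim_seq (fun n => F n * G n) l ->
  is_series (fun k => (F (S k) - F k) * G k + F (S k) * (G (S k) - G k)) l.
Proof.
  intros H0 Hl.
  apply is_series_of_partial_sums with (fun n => F (S n) * G (S n)).
  - induction n as [|n IH].
    + rewrite sum_O. lra.
    + rewrite sum_n_succ, IH. ring.
  - now apply is_lim_seq_incr_1 in Hl.
Qed.

(** * Harmonic numbers *)

Lemma INR_S_pos (n : nat) : 0 < INR (S n).
Proof. apply lt_0_INR. lia. Qed.

Lemma INR_S_pow_pos (n k : nat) : 0 < INR (S n) ^ k.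
Proof. apply pow_lt, INR_S_pos. Qed.

Lemma INR_S_ge_1 (n : nat) : 1 <= INR (S n).
Proof. rewrite S_INR. pose proof (pos_INR n). lra. Qed.

Lemma harmonic_0 (k : nat) : harmonic k 0 = 0.
Proof. unfold harmonic. now rewrite sum_n_m_zero by lia. Qed.

Lemma harmonic_S (k n : nat) : harmonic k (S n) = harmonic k n + / INR (S n) ^ k.
Proof. unfold harmonic. now rewrite sum_n_m_succ by lia. Qed.

Lemma harmonic_nonneg (k n : nat) : 0 <= harmonic k n.
Proof.
  induction n as [|n IH]; [rewrite harmonic_0; lra|].
  rewrite harmonic_S. pose proof (Rinv_0_lt_compat _ (INR_S_pow_pos n k)). lra.
Qed.

Lemma inv_pow_le (n p q : nat) : (p <= q)%nat -> / INR (S n) ^ q <= / INR (S n) ^ p.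
Proof.
  intros H. apply Rinv_le_contravar; [apply INR_S_pow_pos|].
  apply Rle_pow; [apply INR_S_ge_1|exact H].
Qed.

Lemma harmonic_le (p q n : nat) : (p <= q)%nat -> harmonic q n <= harmonic p n.
Proof.
  intros H. induction n as [|n IH]; [rewrite !harmonic_0; lra|].
  rewrite !harmonic_S. pose proof (inv_pow_le n p q H). lra.
Qed.

Lemma harmonic_le_2 (k n : nat) : (2 <= k)%nat -> harmonic k n <= 2.
Proof.
  intros Hk. apply Rle_trans with (harmonic 2 n); [now apply harmonic_le|].
  destruct n as [|n]; [rewrite harmonic_0; lra|].
  (* The correction 1/n makes the bound inductive, since 1/(n+1)^2 <= 1/n - 1/(n+1). *)
  enough (harmonic 2 (S n) <= 2 - / INR (S n)).
  { pose proof (Rinv_0_lt_compat _ (INR_S_pos n)). lra. }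
  induction n as [|n IH].
  - rewrite harmonic_S, harmonic_0. simpl. lra.
  - rewrite harmonic_S. apply Rle_trans with (2 - / INR (S n) + / INR (S (S n)) ^ 2).
    { lra. }
    rewrite (S_INR (S n)). pose proof (INR_S_pos n) as Hx.
    set (x := INR (S n)) in *.
    enough (0 <= / x - / (x + 1) - / (x + 1) ^ 2) by lra.
    replace (/ x - / (x + 1) - / (x + 1) ^ 2) with (/ (x * (x + 1) ^ 2)) by (field; lra).
    left. apply Rinv_0_lt_compat. nra.
Qed.

Lemma sum_n_inv_pow (k n : nat) : sum_n (fun m => / INR (S m) ^ k) n = harmonic k (S n) :> R.
Proof.
  induction n as [|n IH].
  - rewrite sum_O, harmonic_S, harmonic_0. ring.
  - now rewrite sum_n_succ, IH, (harmonic_S k (S n)).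
Qed.

Lemma is_series_zeta (k : nat) : (2 <= k)%nat ->
  is_series (fun m => / INR (S m) ^ k) (zeta k).
Proof.
  intros Hk. apply Series_correct.
  destruct (ex_series_of_bounded_sums (fun m => / INR (S m) ^ k) 2) as [l [Hl _]].
  - intros m. left. apply Rinv_0_lt_compat, INR_S_pow_pos.
  - intros n. rewrite sum_n_inv_pow. now apply harmonic_le_2.
  - now exists l.
Qed.

Lemma is_lim_seq_harmonic (k : nat) : (2 <= k)%nat ->
  is_lim_seq (harmonic k) (zeta k).
Proof.
  intros Hk. apply is_lim_seq_incr_1.
  apply (is_lim_seq_ext (sum_n (fun m => / INR (S m) ^ k))).
  - apply sum_n_inv_pow.
  - now apply is_series_zeta.
Qed.

(* Telescoping: [H_n / (n (n-1)) = G (n-1) - G n] for [G n = (H_n + 1) / n]. *)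
Lemma sum_harmonic_div_sq_le (n : nat) :
  sum_n (fun m => harmonic 1 (S m) / INR (S m) ^ 2) n <= 3.
Proof.
  enough (sum_n (fun m => harmonic 1 (S m) / INR (S m) ^ 2) n
          <= 3 - (harmonic 1 (S n) + 1) / INR (S n)).
  { assert (0 <= (harmonic 1 (S n) + 1) / INR (S n)); [|lra].
    apply Rdiv_le_0_compat; [|apply INR_S_pos].
    pose proof (harmonic_nonneg 1 (S n)). lra. }
  induction n as [|n IH].
  - rewrite sum_O, harmonic_S, harmonic_0. simpl. lra.
  - rewrite sum_n_succ.
    eapply Rle_trans; [apply Rplus_le_compat_r, IH|].
    rewrite (harmonic_S 1 (S n)), (S_INR (S n)).
    pose proof (harmonic_nonneg 1 (S n)) as Hh.
    pose proof (INR_S_pos n) as Hx.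
    set (x := INR (S n)) in *. set (h := harmonic 1 (S n)) in *.
    assert (E : 3 - (h + / (x + 1) ^ 1 + 1) / (x + 1)
      - (3 - (h + 1) / x + (h + / (x + 1) ^ 1) / (x + 1) ^ 2)
      = (h + / (x + 1)) * / (x * (x + 1) ^ 2)) by (field; lra).
    assert (0 <= (h + / (x + 1)) * / (x * (x + 1) ^ 2)); [|lra].
    apply Rmult_le_pos.
    + assert (0 < / (x + 1)) by (apply Rinv_0_lt_compat; lra). lra.
    + left. apply Rinv_0_lt_compat. nra.
Qed.

Lemma ex_series_harmonic_div_sq :
  ex_series (fun m => harmonic 1 (S m) / INR (S m) ^ 2).
Proof.
  destruct (ex_series_of_bounded_sums
    (fun m => harmonic 1 (S m) / INR (S m) ^ 2) 3) as [l [Hl _]].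
  - intros k. apply Rdiv_le_0_compat; [apply harmonic_nonneg|apply INR_S_pow_pos].
  - apply sum_harmonic_div_sq_le.
  - now exists l.
Qed.

(** * Convergence of Euler sums *)

(** Comparison with C H_n / n^2. The factor H_n leaves room for one harmonic number of order 1 in
    the numerator. *)
Lemma ex_series_harmonic_bound (f : nat -> R) (C : R) (q : nat) :
  (2 <= q)%nat -> (forall m, 0 <= f m <= C * harmonic 1 (S m)) ->
  ex_series (fun m => f m / INR (S m) ^ q).
Proof.
  intros Hq Hf.
  apply ex_series_dominated with (fun m => C * (harmonic 1 (S m) / INR (S m) ^ 2)).
  - intros m. destruct (Hf m) as [H0 H1].
    pose proof (Rinv_0_lt_compat _ (INR_S_pow_pos m q)) as Hi.
    pose proof (inv_pow_le m 2 q Hq).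
    split; [apply Rmult_le_pos; lra|].
    unfold Rdiv. rewrite <- Rmult_assoc.
    apply Rmult_le_compat; lra.
  - destruct ex_series_harmonic_div_sq as [l Hl].
    exists (C * l). now apply is_series_Rscal.
Qed.

Definition euler_num (s : list nat) (n : nat) : R :=
  fold_right Rmult 1 (map (fun k => harmonic k n) s).

Lemma euler_num_bounds (s : list nat) (n : nat) :
  List.Forall (fun k => (2 <= k)%nat) s -> 0 <= euler_num s n <= 2 ^ length s.
Proof.
  intros H. induction H as [|k s Hk Hs [IH0 IH1]].
  - unfold euler_num. simpl. lra.
  - change (0 <= harmonic k n * euler_num s n <= 2 * 2 ^ length s).
    pose proof (harmonic_nonneg k n). pose proof (harmonic_le_2 k n Hk).
    split; [apply Rmult_le_pos; lra|]. apply Rmult_le_compat; lra.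
Qed.

(** Only the head index may be 1: its factor is at most H_n, while every other factor is at most
    2. *)
Lemma is_series_euler_sum (j : nat) (s : list nat) (q : nat) :
  (1 <= j)%nat -> List.Forall (fun k => (2 <= k)%nat) s -> (2 <= q)%nat ->
  is_series (fun m => euler_num (j :: s) (S m) / INR (S m) ^ q) (euler_sum (j :: s) q).
Proof.
  intros Hj Hs Hq. apply Series_correct.
  apply ex_series_harmonic_bound with (2 ^ length s); [exact Hq|].
  intros m.
  change (0 <= harmonic j (S m) * euler_num s (S m) <= 2 ^ length s * harmonic 1 (S m)).
  destruct (euler_num_bounds s (S m) Hs).
  pose proof (harmonic_nonneg j (S m)). pose proof (harmonic_le 1 j (S m) Hj).
  split; [apply Rmult_le_pos; lra|]. rewrite Rmult_comm. apply Rmult_le_compat; lra.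
Qed.

Lemma is_series_linear (p q : nat) : (1 <= p)%nat -> (2 <= q)%nat ->
  is_series (fun m => harmonic p (S m) / INR (S m) ^ q) (euler_sum [p] q).
Proof.
  intros Hp Hq. eapply is_series_Rext; [|now apply (is_series_euler_sum p [])].
  intros m. unfold euler_num, fold_right, map. now rewrite Rmult_1_r.
Qed.

Lemma is_series_quadratic (p i q : nat) :
  (2 <= p)%nat -> (1 <= i)%nat -> (2 <= q)%nat ->
  is_series (fun m => harmonic p (S m) * harmonic i (S m) / INR (S m) ^ q)
    (euler_sum [p; i] q).
Proof.
  intros Hp Hi Hq.
  apply (is_series_Rext (fun m => euler_num [p; i] (S m) / INR (S m) ^ q)).
  { intros m. unfold euler_num, fold_right, map. now rewrite Rmult_1_r. }
  apply Series_correct.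
  (* The order of the factors is swapped because [i] may be 1, which is allowed only at the head. *)
  exists (euler_sum [i; p] q).
  apply (is_series_Rext (fun m => euler_num [i; p] (S m) / INR (S m) ^ q)).
  { intros m. unfold euler_num, fold_right, map, Rdiv. ring. }
  apply is_series_euler_sum; auto.
Qed.

(** * Series with shifted denominators *)

Lemma is_lim_seq_inv_shift (c : R) : 0 <= c ->
  is_lim_seq (fun n => / (INR (S n) + c)) 0.
Proof.
  intros Hc.
  apply (is_lim_seq_le_le (fun _ => 0) _ (fun n => / INR (S n))).
  - intros n. pose proof (INR_S_pos n). split.
    + left. apply Rinv_0_lt_compat. lra.
    + apply Rinv_le_contravar; lra.
  - apply is_lim_seq_const.
  - apply (is_lim_seq_incr_1 (fun n => / INR n)).
    replace (Finite 0) with (Rbar_inv p_infty) by reflexivity.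
    apply is_lim_seq_inv; [apply is_lim_seq_INR|discriminate].
Qed.

(** Passing from j to j+1 adds the telescoping series of 1/(k+j) - 1/(k+j+1) over k >= 1, whose sum
    is 1/(j+1). *)
Lemma is_series_inv_telescope (j : nat) :
  is_series (fun k => / INR (S k) - / (INR (S k) + INR j)) (harmonic 1 j).
Proof.
  induction j as [|j IH].
  - rewrite harmonic_0. apply is_series_Rext with (fun _ => 0); [|exact is_series_zero].
    intros n. change (INR 0) with 0. rewrite Rplus_0_r. ring.
  - rewrite harmonic_S.
    apply is_series_Rext with (fun k => (/ INR (S k) - / (INR (S k) + INR j))
      + (/ (INR (S k) + INR j) - / (INR (S (S k)) + INR j))).
    { intros k. rewrite (S_INR j), (S_INR (S k)).
      replace (INR (S k) + 1 + INR j) with (INR (S k) + (INR j + 1)) by ring. ring. }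
    apply is_series_Rplus; [exact IH|].
    apply is_series_of_partial_sums with
      (fun n => / INR (S j) ^ 1 - / (INR (S (S n)) + INR j)).
    + assert (E : INR 1 + INR j = INR (S j)) by (rewrite (S_INR j); simpl; ring).
      induction n as [|n IHn].
      * rewrite sum_O, E. simpl pow. now rewrite Rmult_1_r.
      * rewrite sum_n_succ, IHn. ring.
    + replace (Finite (/ INR (S j) ^ 1)) with (Finite (/ INR (S j) ^ 1 - 0))
        by (f_equal; ring).
      apply is_lim_seq_minus'; [apply is_lim_seq_const|].
      apply (is_lim_seq_incr_1 (fun n => / (INR (S n) + INR j))).
      apply is_lim_seq_inv_shift, pos_INR.
Qed.

(** The sequence [g] is a parameter because the same alternating combination of zeta values is
    applied to inverse powers, harmonic numbers and Euler sums. *)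
Definition alt_zeta (p : nat) (g : nat -> R) : R :=
  sum_n_m (fun i => (-1) ^ (i - 1) * zeta (p + 1 - i) * g i) 1 (p - 1).

Lemma alt_zeta_ext (p : nat) (g h : nat -> R) :
  (forall i, (1 <= i <= p - 1)%nat -> g i = h i) -> alt_zeta p g = alt_zeta p h.
Proof. intros H. apply sum_n_m_Rext. intros i Hi. now rewrite H. Qed.

Lemma alt_zeta_plus (p : nat) (g h : nat -> R) :
  alt_zeta p (fun i => g i + h i) = alt_zeta p g + alt_zeta p h.
Proof.
  unfold alt_zeta. rewrite <- sum_n_m_Rplus.
  apply sum_n_m_Rext. intros i _. ring.
Qed.

Lemma alt_zeta_0 (p : nat) : alt_zeta p (fun _ => 0) = 0.
Proof.
  unfold alt_zeta. rewrite (sum_n_m_Rext _ (fun _ => 0 * 0)).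
  - rewrite sum_n_m_Rscal. ring.
  - intros i _. ring.
Qed.

(** Splitting off i = 1 and shifting the other indices gives the recurrence that drives the
    induction in [is_series_inv_pow_shift]. *)
Lemma alt_zeta_inv_pow_S (p : nat) (x : R) : x <> 0 ->
  alt_zeta (S (S p)) (fun i => / x ^ i)
  = (zeta (S (S p)) - alt_zeta (S p) (fun i => / x ^ i)) / x.
Proof.
  intros Hx. unfold alt_zeta.
  replace (S (S p) - 1)%nat with (S p) by lia. replace (S p - 1)%nat with p by lia.
  rewrite sum_Sn_m by lia. rewrite <- sum_n_m_S. change plus with Rplus.
  replace (S (S p) + 1 - 1)%nat with (S (S p)) by lia.
  replace ((zeta (S (S p))
     - sum_n_m (fun i => (-1) ^ (i - 1) * zeta (S p + 1 - i) * / x ^ i) 1 p) / x)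
    with (zeta (S (S p)) / x +
     (- / x) * sum_n_m (fun i => (-1) ^ (i - 1) * zeta (S p + 1 - i) * / x ^ i) 1 p)
    by (field; exact Hx).
  rewrite <- sum_n_m_Rscal.
  f_equal.
  - simpl. field. exact Hx.
  - apply sum_n_m_Rext. intros i Hi.
    replace (S (S p) + 1 - S i)%nat with (S p + 1 - i)%nat by lia.
    replace (S i - 1)%nat with (S (i - 1)) by lia. simpl.
    field. split; [now apply pow_nonzero|exact Hx].
Qed.

(** Induction on [p] by 1/(k^(p+2) (k+x)) = (1/x) (1/k^(p+2) - 1/(k^(p+1) (k+x))), starting from the
    telescoping series. *)
Lemma is_series_inv_pow_shift (p j : nat) :
  is_series (fun k => / (INR (S k) ^ S p * (INR (S k) + INR (S j))))
    (alt_zeta (S p) (fun i => / INR (S j) ^ i)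
     + (-1) ^ p * (harmonic 1 (S j) / INR (S j) ^ S p)).
Proof.
  pose proof (INR_S_pos j) as Hj.
  induction p as [|p IH].
  - unfold alt_zeta. rewrite sum_n_m_empty by lia.
    apply is_series_value with (/ INR (S j) * harmonic 1 (S j)).
    { rewrite pow_O, pow_1. field. lra. }
    apply is_series_Rext with
      (fun k => / INR (S j) * (/ INR (S k) - / (INR (S k) + INR (S j)))).
    { intros k. pose proof (INR_S_pos k). field. repeat split; try lra. }
    apply is_series_Rscal, is_series_inv_telescope.
  - rewrite alt_zeta_inv_pow_S by lra.
    match type of IH with is_series _ ?l => set (L := l) in IH end.
    apply is_series_value with (/ INR (S j) * (zeta (S (S p)) - L)).
    + unfold L. pose proof (INR_S_pow_pos j p). rewrite <- !tech_pow_Rmult.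
      field. lra.
    + apply is_series_Rext with (fun k => / INR (S j) *
        (/ INR (S k) ^ S (S p) - / (INR (S k) ^ S p * (INR (S k) + INR (S j))))).
      { intros k. pose proof (INR_S_pos k). pose proof (INR_S_pow_pos k p).
        rewrite <- !tech_pow_Rmult. field. repeat split; lra. }
      apply is_series_Rscal, is_series_Rminus; [|exact IH].
      apply is_series_zeta. lia.
Qed.

(** Abel summation moves the difference from 1/(n+c) to H_n^(p), whose increments are n^(-p). The
    boundary term tends to zeta(p) * 0. *)
Lemma is_series_harmonic_diff (p : nat) (c w : R) : (2 <= p)%nat -> 0 <= c ->
  is_series (fun k => / (INR (S k) ^ p * (INR (S k) + c))) w ->
  is_series (fun n => harmonic p (S n) * (/ (INR (S n) + c) - / (INR (S n) + (c + 1)))) w.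
Proof.
  intros Hp Hc Hw.
  assert (HA : is_series (fun k =>
    (harmonic p (S k) - harmonic p k) * / (INR (S k) + c)
    + harmonic p (S k) * (/ (INR (S (S k)) + c) - / (INR (S k) + c))) (zeta p * 0)).
  { apply (is_series_abel (harmonic p) (fun k => / (INR (S k) + c))).
    - rewrite harmonic_0. ring.
    - apply is_lim_seq_mult'; [now apply is_lim_seq_harmonic|].
      now apply is_lim_seq_inv_shift. }
  replace w with (w - zeta p * 0) by ring.
  eapply is_series_Rext; [|apply is_series_Rminus; [exact Hw|exact HA]].
  intros n. cbv beta. rewrite harmonic_S, (S_INR (S n)).
  pose proof (INR_S_pos n). pose proof (INR_S_pow_pos n p). field. repeat split; lra.
Qed.

Definition partial_linear_sum (p k : nat) : R :=
  sum_n_m (fun j => harmonic 1 j / INR j ^ p) 1 k.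

Lemma partial_linear_sum_S (p k : nat) :
  partial_linear_sum p (S k)
  = partial_linear_sum p k + harmonic 1 (S k) / INR (S k) ^ p.
Proof. unfold partial_linear_sum. now rewrite sum_n_m_succ by lia. Qed.

(** This evaluates U_p(m+1), by induction on [m]. The increment U_p(m+2) - U_p(m+1) comes from
    [is_series_harmonic_diff] with c = m+1 and [is_series_inv_pow_shift]. *)
Lemma is_series_harmonic_shift (p m : nat) : (2 <= p)%nat ->
  is_series (fun n => harmonic p (S n) * (/ INR (S n) - / (INR (S n) + INR (S m))))
    (zeta (p + 1) + alt_zeta p (fun i => harmonic i m)
     + (-1) ^ (p - 1) * partial_linear_sum p m).
Proof.
  intros Hp. induction m as [|m IH].
  - apply is_series_value with (zeta (p + 1)).
    + rewrite (alt_zeta_ext p _ (fun _ => 0)) by (intros; apply harmonic_0).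
      rewrite alt_zeta_0. unfold partial_linear_sum.
      rewrite sum_n_m_empty by lia. ring.
    (* U_p(1) is the case c = 0 of [is_series_harmonic_diff]. *)
    + apply is_series_Rext with
        (fun n => harmonic p (S n) * (/ (INR (S n) + 0) - / (INR (S n) + (0 + 1)))).
      { intros n. now rewrite Rplus_0_r, Rplus_0_l. }
      apply is_series_harmonic_diff; [exact Hp|lra|].
      apply is_series_Rext with (fun k => / INR (S k) ^ (p + 1)).
      { intros n. rewrite pow_add, Rplus_0_r. f_equal. now rewrite pow_1, Rmult_comm. }
      apply is_series_zeta. lia.
  - assert (HW := is_series_inv_pow_shift (p - 1) m).
    replace (S (p - 1)) with p in HW by lia.
    apply (is_series_harmonic_diff p (INR (S m)) _ Hp (pos_INR _)) in HW.
    rewrite partial_linear_sum_S.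
    rewrite (alt_zeta_ext p _ (fun i => harmonic i m + / INR (S m) ^ i))
      by (intros; apply harmonic_S).
    rewrite alt_zeta_plus.
    apply is_series_value with
      (zeta (p + 1) + alt_zeta p (fun i => harmonic i m)
        + (-1) ^ (p - 1) * partial_linear_sum p m
       + (alt_zeta p (fun i => / INR (S m) ^ i)
          + (-1) ^ (p - 1) * (harmonic 1 (S m) / INR (S m) ^ p))); [ring|].
    eapply is_series_Rext; [|apply is_series_Rplus; [exact IH|exact HW]].
    intros n. cbv beta. rewrite (S_INR (S m)). ring.
Qed.

(** * Sums of products of harmonic numbers *)

Lemma sum_n_partial_linear_sum (p n : nat) :
  sum_n (fun m => harmonic 1 (S m) / INR (S m) ^ p) n
  = partial_linear_sum p (S n) :> R.
Proof.
  induction n as [|n IH].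
  - rewrite sum_O, partial_linear_sum_S. unfold partial_linear_sum.
    rewrite sum_n_m_empty by lia. ring.
  - now rewrite sum_n_succ, IH, (partial_linear_sum_S p (S n)).
Qed.

Lemma is_lim_seq_partial_linear_sum (p : nat) : (2 <= p)%nat ->
  is_lim_seq (partial_linear_sum p) (euler_sum [1%nat] p).
Proof.
  intros Hp. apply is_lim_seq_incr_1.
  apply (is_lim_seq_ext (sum_n (fun m => harmonic 1 (S m) / INR (S m) ^ p))).
  - apply sum_n_partial_linear_sum.
  - apply is_lim_seq_partial_sums, is_series_linear; [lia|exact Hp].
Qed.

Lemma partial_linear_sum_bounds (p k : nat) : (2 <= p)%nat ->
  0 <= partial_linear_sum p k <= euler_sum [1%nat] p.
Proof.
  intros Hp.
  assert (H0 : forall m, 0 <= harmonic 1 (S m) / INR (S m) ^ p).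
  { intros m. apply Rdiv_le_0_compat; [apply harmonic_nonneg|apply INR_S_pow_pos]. }
  assert (Hi : forall n, partial_linear_sum p n <= partial_linear_sum p (S n)).
  { intros n. rewrite partial_linear_sum_S. specialize (H0 n). lra. }
  split.
  - induction k as [|k IH].
    + unfold partial_linear_sum. rewrite sum_n_m_empty by lia. apply Rle_refl.
    + specialize (Hi k). lra.
  - apply (is_lim_seq_incr_compare (partial_linear_sum p)); [|exact Hi].
    now apply is_lim_seq_partial_linear_sum.
Qed.

(** With n = m+1 the summand is H_n^(q) n^(-l) sum_(j<n) H_j / j^p: the inner sum is strict. *)
Definition nested_sum (q l p : nat) : R :=
  Series (fun m => harmonic q (S m) * partial_linear_sum p m / INR (S m) ^ l).

Lemma is_series_nested_sum (q l p : nat) :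
  (2 <= q)%nat -> (2 <= l)%nat -> (2 <= p)%nat ->
  is_series (fun m => harmonic q (S m) * partial_linear_sum p m / INR (S m) ^ l)
    (nested_sum q l p).
Proof.
  intros Hq Hl Hp. apply Series_correct.
  apply ex_series_harmonic_bound with (euler_sum [1%nat] p); [exact Hl|].
  intros m. pose proof (harmonic_nonneg q (S m)).
  destruct (partial_linear_sum_bounds p m Hp).
  assert (harmonic q (S m) <= harmonic 1 (S m)) by (apply harmonic_le; lia).
  split; [apply Rmult_le_pos; lra|].
  rewrite Rmult_comm. apply Rmult_le_compat; lra.
Qed.

(** The value of sum_m H_m^(q) U_p(m) / m^l. The differences of Euler sums come from H_(m-1)^(i) =
    H_m^(i) - m^(-i). *)
Definition reduced_sum (q l p : nat) : R :=
  zeta (p + 1) * euler_sum [q] l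
  + alt_zeta p (fun i => euler_sum [q; i] l - euler_sum [q] (l + i))
  + (-1) ^ (p - 1) * nested_sum q l p.

Lemma is_series_alt_zeta (p : nat) (f : nat -> nat -> R) (L : nat -> R) :
  (forall i, (1 <= i <= p - 1)%nat -> is_series (f i) (L i)) ->
  is_series (fun k => alt_zeta p (fun i => f i k)) (alt_zeta p L).
Proof.
  intros H. unfold alt_zeta.
  apply (is_series_sum_n_m (fun i k => (-1) ^ (i - 1) * zeta (p + 1 - i) * f i k)).
  intros i Hi. now apply is_series_Rscal, H.
Qed.

Lemma alt_zeta_scal (p : nat) (c : R) (g : nat -> R) :
  c * alt_zeta p g = alt_zeta p (fun i => c * g i).
Proof.
  unfold alt_zeta. rewrite <- sum_n_m_Rscal.
  apply sum_n_m_Rext. intros i _. ring.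
Qed.

Lemma is_series_reduced_sum (q l p : nat) :
  (2 <= q)%nat -> (2 <= l)%nat -> (2 <= p)%nat ->
  is_series (fun m => harmonic q (S m) / INR (S m) ^ l *
    (zeta (p + 1) + alt_zeta p (fun i => harmonic i m)
     + (-1) ^ (p - 1) * partial_linear_sum p m)) (reduced_sum q l p).
Proof.
  intros Hq Hl Hp.
  apply is_series_Rext with (fun m =>
    zeta (p + 1) * (harmonic q (S m) / INR (S m) ^ l)
    + alt_zeta p (fun i => harmonic q (S m) * harmonic i (S m) / INR (S m) ^ l
        - harmonic q (S m) / INR (S m) ^ (l + i))
    + (-1) ^ (p - 1) * (harmonic q (S m) * partial_linear_sum p m / INR (S m) ^ l)).
  { intros m. rewrite !Rmult_plus_distr_l, alt_zeta_scal.
    f_equal; [f_equal|].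
    - ring.
    - apply alt_zeta_ext. intros i _. rewrite (harmonic_S i m), pow_add.
      pose proof (INR_S_pow_pos m l). pose proof (INR_S_pow_pos m i). field. lra.
    - unfold Rdiv. ring. }
  apply is_series_Rplus; [apply is_series_Rplus|]; [apply is_series_Rscal| |apply is_series_Rscal].
  - apply is_series_linear; lia.
  - apply is_series_alt_zeta. intros i Hi.
    apply is_series_Rminus; [apply is_series_quadratic|apply is_series_linear]; lia.
  - now apply is_series_nested_sum.
Qed.

(** * Exchange of the order of summation *)

(** A finite geometric sum of ratio -y/x. With k = l-2 it relates the two kernels 1/(x y^(l-1)
    (x+y)) and 1/(x^(l-1) y (x+y)). *)
Lemma alternating_partial_fractions (x y : R) (k : nat) : 0 < x -> 0 < y ->
  sum_n_m (fun i => (-1) ^ (i - 1) * / x ^ (i + 1) * / y ^ (k + 2 - i)) 1 k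
  = / (x * y ^ S k * (x + y)) - (-1) ^ k * / (x ^ S k * y * (x + y)) :> R.
Proof.
  intros Hx Hy. induction k as [|k IH].
  - rewrite sum_n_m_empty by lia. simpl. field. lra.
  - rewrite sum_n_m_succ by lia.
    rewrite (sum_n_m_Rext _ (fun i =>
      / y * ((-1) ^ (i - 1) * / x ^ (i + 1) * / y ^ (k + 2 - i)))).
    + rewrite sum_n_m_Rscal, IH.
      replace (S k - 1)%nat with k by lia.
      replace (S k + 1)%nat with (S (S k)) by lia.
      replace (S k + 2 - S k)%nat with 2%nat by lia.
      pose proof (pow_lt x k Hx). pose proof (pow_lt y k Hy).
      rewrite <- !tech_pow_Rmult. simpl (y ^ 0). field. repeat split; lra.
    + intros i Hi.
      replace (S k + 2 - i)%nat with (S (k + 2 - i)) by lia.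
      rewrite <- tech_pow_Rmult. rewrite (Rinv_mult y). ring.
Qed.

Lemma sign_mult_self (k : nat) : (-1) ^ k * (-1) ^ k = 1.
Proof. rewrite <- pow_add. replace (k + k)%nat with (2 * k)%nat by lia. apply pow_1_even. Qed.

(* Both sides are iterated sums of [H_n^(p) H_m^(q) / (n^(l-1) m (n+m))]: over [m]
   first on the [reduced_sum p l q] side, over [n] first, after expanding into
   partial fractions, on the other. *)
Lemma reduced_sum_exchange (p q l : nat) :
  (2 <= p)%nat -> (2 <= q)%nat -> (2 <= l)%nat ->
  sum_n_m (fun i : nat => (-1) ^ (i - 1)
        * euler_sum [p] (i + 1) * euler_sum [q] (l - i)) 1 (l - 2)
  = reduced_sum q l p - (-1) ^ l * reduced_sum p l q :> R.
Proof.
  intros Hp Hq Hl.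
  set (a := fun n m => harmonic p (S n) * harmonic q (S m)
    / (INR (S n) ^ (l - 1) * INR (S m) * (INR (S n) + INR (S m)))).
  (* The column sums of [a]: partial fractions turn the kernel into U_p and a finite sum of
     separated powers of n and m. *)
  set (c := fun m => (-1) ^ l * (harmonic q (S m) / INR (S m) ^ l *
    (zeta (p + 1) + alt_zeta p (fun i => harmonic i m)
     + (-1) ^ (p - 1) * partial_linear_sum p m)
    - sum_n_m (fun i => (-1) ^ (i - 1) * euler_sum [p] (i + 1)
        * (harmonic q (S m) / INR (S m) ^ (l - i))) 1 (l - 2))).
  assert (Hc : is_series c (reduced_sum p l q)).
  { eapply (tonelli a); [| |now apply (is_series_reduced_sum p l q)|].
    - intros n m. pose proof (INR_S_pos n). pose proof (INR_S_pos m).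
      pose proof (INR_S_pow_pos n (l - 1)).
      apply Rdiv_le_0_compat; [apply Rmult_le_pos; apply harmonic_nonneg|].
      repeat apply Rmult_lt_0_compat; lra.
    - intros n. eapply is_series_Rext;
        [|apply is_series_Rscal, (is_series_harmonic_shift q n Hq)].
      intros m. unfold a. pose proof (INR_S_pos n). pose proof (INR_S_pos m).
      pose proof (INR_S_pow_pos n (l - 1)).
      replace (INR (S n) ^ l) with (INR (S n) * INR (S n) ^ (l - 1))
        by (rewrite tech_pow_Rmult; f_equal; lia).
      field. repeat split; lra.
    - intros m. unfold c.
      eapply is_series_Rext; [|apply is_series_Rscal, is_series_Rminus;
        [apply is_series_Rscal, (is_series_harmonic_shift p m Hp)
        |apply (is_series_sum_n_m (fun i n => (-1) ^ (i - 1)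
           * (harmonic p (S n) / INR (S n) ^ (i + 1))
           * (harmonic q (S m) / INR (S m) ^ (l - i))))]].
      + intros n. cbv beta. unfold a.
        pose proof (INR_S_pos n) as Hx. pose proof (INR_S_pos m) as Hy.
        rewrite (sum_n_m_Rext _ (fun i => harmonic p (S n) * harmonic q (S m) *
          ((-1) ^ (i - 1) * / INR (S n) ^ (i + 1) * / INR (S m) ^ (l - 2 + 2 - i)))).
        2:{ intros i Hi.
            replace (l - 2 + 2 - i)%nat with (l - i)%nat by lia. unfold Rdiv. ring. }
        rewrite sum_n_m_Rscal, alternating_partial_fractions by assumption.
        assert (Hs := sign_mult_self (l - 2)).
        replace (S (l - 2)) with (l - 1)%nat by lia.
        replace ((-1) ^ l) with ((-1) ^ (l - 2))
          by (replace l with (2 + (l - 2))%nat at 2 by lia; rewrite pow_add; ring).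
        replace (INR (S m) ^ l) with (INR (S m) * INR (S m) ^ (l - 1))
          by (rewrite tech_pow_Rmult; f_equal; lia).
        pose proof (INR_S_pow_pos n (l - 1)). pose proof (INR_S_pow_pos m (l - 1)).
        set (e := (-1) ^ (l - 2)) in *.
        (* The factor e^2 = 1 is inserted so that both sides agree as rational functions in a free
           variable [e], as [field] requires. *)
        transitivity (e * e * (harmonic p (S n) * harmonic q (S m)
          / (INR (S n) ^ (l - 1) * INR (S m) * (INR (S n) + INR (S m)))));
          [|rewrite Hs; ring].
        field. repeat split; lra.
      + intros i Hi.
        replace ((-1) ^ (i - 1) * euler_sum [p] (i + 1) * (harmonic q (S m) / INR (S m) ^ (l - i)))
          with ((-1) ^ (i - 1) * (harmonic q (S m) / INR (S m) ^ (l - i)) * euler_sum [p] (i + 1))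
          by ring.
        eapply is_series_Rext; [|apply is_series_Rscal, (is_series_linear p (i + 1)); lia].
        intros n. cbv beta. ring. }
  match goal with |- ?s = _ => set (A := s : R) end.
  (* Summing [c] term by term gives a second value for the same series; comparing the two yields the
     relation. *)
  assert (Hc' : is_series c ((-1) ^ l * (reduced_sum q l p - A))).
  { apply is_series_Rscal, is_series_Rminus; [now apply is_series_reduced_sum|].
    apply (is_series_sum_n_m (fun i m => (-1) ^ (i - 1) * euler_sum [p] (i + 1)
      * (harmonic q (S m) / INR (S m) ^ (l - i)))).
    intros i Hi. apply is_series_Rscal, is_series_linear; lia. }
  rewrite (is_series_eq _ _ _ Hc Hc').
  rewrite <- Rmult_assoc, sign_mult_self. ring.
Qed.

(** * Abel summation over pairs of orders *)

(** With n = m+1, the increment of H^(a) H^(b) is H_n^(a) / n^b + H_n^(b) / n^a - n^(-a-b), and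
    n^(-a-b) is the increment of H^(a+b). The weight [G] is 1 for linear sums and a partial sum of
    S_(1,c) for nested ones. *)
Lemma is_series_harmonic_product (a b : nat) (G : nat -> R) :
  forall s, is_series (fun m => (harmonic a (S m) * harmonic b (S m)
      - harmonic a m * harmonic b m) * G m) s ->
  forall s', is_series (fun m => (harmonic (a + b) (S m) - harmonic (a + b) m) * G m) s' ->
  is_series (fun m => harmonic a (S m) * G m / INR (S m) ^ b
    + harmonic b (S m) * G m / INR (S m) ^ a) (s + s').
Proof.
  intros s Hs s' Hs'.
  eapply is_series_Rext; [|apply is_series_Rplus; [exact Hs|exact Hs']].
  intros m. cbv beta. rewrite !harmonic_S, pow_add.
  pose proof (INR_S_pow_pos m a). pose proof (INR_S_pow_pos m b). field. lra.
Qed.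

Lemma euler_sum_reflection (a b : nat) : (2 <= a)%nat -> (2 <= b)%nat ->
  euler_sum [a] b + euler_sum [b] a = zeta a * zeta b + zeta (a + b).
Proof.
  intros Ha Hb.
  apply (is_series_eq (fun m => harmonic a (S m) * 1 / INR (S m) ^ b
    + harmonic b (S m) * 1 / INR (S m) ^ a)).
  - eapply is_series_Rext; [|apply is_series_Rplus; apply is_series_linear; lia].
    intros m. cbv beta. now rewrite !Rmult_1_r.
  - apply (is_series_harmonic_product a b (fun _ => 1)).
    + eapply is_series_Rext;
        [|apply (is_series_abel (fun k => harmonic a k * harmonic b k) (fun _ => 1))].
      * intros m. cbv beta. ring.
      * rewrite harmonic_0. ring.
      * eapply is_lim_seq_ext; [|apply is_lim_seq_mult';
          [apply (is_lim_seq_harmonic a Ha)|apply (is_lim_seq_harmonic b Hb)]].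
        intros n. cbv beta. ring.
    + eapply is_series_Rext; [|apply is_series_zeta; lia].
      intros m. cbv beta. rewrite harmonic_S. ring.
Qed.

(** Abel summation against G = [partial_linear_sum c], whose increments are H_n / n^c. Taking F =
    H^(a) H^(b) produces the cubic sum, and F = H^(a+b) the quadratic one. *)
Lemma nested_sum_reflection (a b c : nat) :
  (2 <= a)%nat -> (2 <= b)%nat -> (2 <= c)%nat ->
  nested_sum a b c + nested_sum b a c
  = (zeta a * zeta b + zeta (a + b)) * euler_sum [1%nat] c
    - euler_sum [1%nat; a; b] c - euler_sum [1; a + b]%nat c.
Proof.
  intros Ha Hb Hc.
  (* Each group is the limit of F G minus the Euler sum left over, for one of the two choices of
     F. *)
  replace (_ - _ - _) with
    ((zeta a * zeta b * euler_sum [1%nat] c - euler_sum [1%nat; a; b] c)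
     + (zeta (a + b) * euler_sum [1%nat] c - euler_sum [1; a + b]%nat c)) by ring.
  eapply is_series_eq.
  - apply is_series_Rplus; apply is_series_nested_sum; assumption.
  - apply is_series_harmonic_product.
    + eapply is_series_Rext; [|apply is_series_Rminus;
        [apply (is_series_abel (fun k => harmonic a k * harmonic b k) (partial_linear_sum c))
        |apply (is_series_euler_sum 1 [a; b])]]; auto.
      * intros m. cbv beta. rewrite partial_linear_sum_S.
        unfold euler_num, fold_right, map, Rdiv. ring.
      * rewrite harmonic_0. ring.
      * apply is_lim_seq_mult'; [apply is_lim_seq_mult'|];
          auto using is_lim_seq_harmonic, is_lim_seq_partial_linear_sum.
    + eapply is_series_Rext; [|apply is_series_Rminus;
        [apply (is_series_abel (harmonic (a + b)) (partial_linear_sum c))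
        |apply (is_series_euler_sum 1 [a + b]%nat)]]; auto.
      * intros m. cbv beta. rewrite partial_linear_sum_S.
        unfold euler_num, fold_right, map, Rdiv. ring.
      * rewrite harmonic_0. ring.
      * apply is_lim_seq_mult'; [apply is_lim_seq_harmonic; lia|].
        now apply is_lim_seq_partial_linear_sum.
      * constructor; [lia|constructor].
Qed.

(** * Signs and combination of the relations *)

Lemma sign_cases (l : nat) : (-1) ^ l = 1 \/ (-1) ^ l = -1.
Proof. induction l as [|l [IH|IH]]; simpl; [|rewrite IH..]; lra. Qed.

Lemma sign_pred (l : nat) : (1 <= l)%nat -> (-1) ^ (l - 1) = - (-1) ^ l.
Proof.
  intros Hl. replace l with (S (l - 1)) at 2 by lia. simpl. ring.
Qed.

Theorem theorem2p2 (l1 l2 l3 : nat)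
  (hl1 : (2 <= l1)%nat) (hl2 : (2 <= l2)%nat) (hl3 : (2 <= l3)%nat)
  (hodd : Nat.Odd (l1 + l2 + l3)) :
  euler_sum [1; l1; l2]%nat l3 + euler_sum [1; l1; l3]%nat l2
    + euler_sum [1; l2; l3]%nat l1
  =
    (-1) ^ l3 * sum_n_m (fun i : nat => (-1) ^ (i - 1)
        * euler_sum [l3] (i + 1) * euler_sum [l1] (l2 - i)) 1 (l2 - 2)
  + euler_sum [1%nat] l1 * (zeta l2 * zeta l3 + zeta (l2 + l3))
  + (-1) ^ l2 * sum_n_m (fun i : nat => (-1) ^ (i - 1)
        * euler_sum [l2] (i + 1) * euler_sum [l3] (l1 - i)) 1 (l1 - 2)
  + euler_sum [1%nat] l2 * (zeta l1 * zeta l3 + zeta (l1 + l3))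
  + (-1) ^ l1 * sum_n_m (fun i : nat => (-1) ^ (i - 1)
        * euler_sum [l1] (i + 1) * euler_sum [l2] (l3 - i)) 1 (l3 - 2)
  + euler_sum [1%nat] l3 * (zeta l1 * zeta l2 + zeta (l1 + l2))
  + (-1) ^ (l1 - 1) * sum_n_m (fun j : nat => (-1) ^ (j - 1) * zeta (l1 + 1 - j)
        * (euler_sum [l3; j] l2 + euler_sum [l2; j] l3
           - euler_sum [l3] (l2 + j) - euler_sum [l2] (l3 + j))) 1 (l1 - 1)
  + (-1) ^ (l2 - 1) * sum_n_m (fun j : nat => (-1) ^ (j - 1) * zeta (l2 + 1 - j)
        * (euler_sum [l3; j] l1 + euler_sum [l1; j] l3
           - euler_sum [l3] (l1 + j) - euler_sum [l1] (l3 + j))) 1 (l2 - 1)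
  + (-1) ^ (l3 - 1) * sum_n_m (fun j : nat => (-1) ^ (j - 1) * zeta (l3 + 1 - j)
        * (euler_sum [l1; j] l2 + euler_sum [l2; j] l1
           - euler_sum [l1] (l2 + j) - euler_sum [l2] (l1 + j))) 1 (l3 - 1)
  + (-1) ^ (l1 - 1) * zeta (l1 + 1) * (zeta l2 * zeta l3 + zeta (l2 + l3))
  + (-1) ^ (l2 - 1) * zeta (l2 + 1) * (zeta l1 * zeta l3 + zeta (l1 + l3))
  + (-1) ^ (l3 - 1) * zeta (l3 + 1) * (zeta l1 * zeta l2 + zeta (l1 + l2))
  - euler_sum [1; l1 + l2]%nat l3 - euler_sum [1; l1 + l3]%nat l2
  - euler_sum [1; l2 + l3]%nat l1.
Proof.
  rewrite (reduced_sum_exchange l3 l1 l2), (reduced_sum_exchange l2 l3 l1),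
    (reduced_sum_exchange l1 l2 l3) by assumption.
  (* Zeta products are traded for linear Euler sums, in which [reduced_sum] is expressed, so that
     the terms with zeta(l+1) cancel. *)
  rewrite <- (euler_sum_reflection l1 l2), <- (euler_sum_reflection l1 l3),
    <- (euler_sum_reflection l2 l3) by assumption.
  assert (N3 := nested_sum_reflection l1 l2 l3 hl1 hl2 hl3).
  assert (N2 := nested_sum_reflection l1 l3 l2 hl1 hl3 hl2).
  assert (N1 := nested_sum_reflection l2 l3 l1 hl2 hl3 hl1).
  rewrite <- (euler_sum_reflection l1 l2) in N3 by assumption.
  rewrite <- (euler_sum_reflection l1 l3) in N2 by assumption.
  rewrite <- (euler_sum_reflection l2 l3) in N1 by assumption.
  (* Each quadratic block splits into the [alt_zeta] parts of two reduced sums, with which it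
     cancels. *)
  assert (Z : forall a b c, sum_n_m (fun j : nat => (-1) ^ (j - 1) * zeta (c + 1 - j)
        * (euler_sum [a; j] b + euler_sum [b; j] a
           - euler_sum [a] (b + j) - euler_sum [b] (a + j))) 1 (c - 1)
      = alt_zeta c (fun i => euler_sum [a; i] b - euler_sum [a] (b + i))
        + alt_zeta c (fun i => euler_sum [b; i] a - euler_sum [b] (a + i)) :> R).
  { intros a b c. rewrite <- alt_zeta_plus. apply sum_n_m_Rext. intros i _. ring. }
  rewrite (Z l3 l2 l1), (Z l3 l1 l2), (Z l1 l2 l3).
  unfold reduced_sum. rewrite !sign_pred by lia.
  (* Nested sums occur with coefficient (-1)^l3 (-1)^(l3-1) = -1, or -(-1)^(l2+l3) (-1)^(l1-1) =
     (-1)^(l1+l2+l3), up to permuting the indices. Odd weight makes the latter -1 too. *)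
  assert (E : (-1) ^ l1 * (-1) ^ l2 * (-1) ^ l3 = -1).
  { rewrite <- !pow_add. destruct hodd as [k ->].
    rewrite Nat.add_1_r. apply pow_1_odd. }
  (* Once the signs are numbers, the goal is linear in the monomials that remain; [E] refutes the
     four patterns of even weight. *)
  destruct (sign_cases l1) as [E1 | E1], (sign_cases l2) as [E2 | E2],
    (sign_cases l3) as [E3 | E3]; rewrite E1, E2, E3 in *; lra.
Qed.
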